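(* Let $\{S_n\}$ and $\{Q_n\}$ be sequences of $n \times n$ matrices with associated distance functions $\{d_n(i,j)\}$. Let each $S_n$ be Hermitian positive definite and partitioned as $$S_n = \begin{bmatrix} A_n & B_n \\ B_n^* & C_n \end{bmatrix}, \quad\text{and let}\quad Q_n = \begin{bmatrix} Z_{A_n} & 0 \\ 0 & Z_{C_n} \end{bmatrix},$$ where $Z_{A_n}$ and $Z_{C_n}$ satisfy $Z_{A_n}^* A_n Z_{A_n} = I$ and $Z_{C_n}^* C_n Z_{C_n} = I$, respectively. Let $\{Z_n\}$ be the sequence of matrices produced by the regular or the localized iterative refinement (both defined in the context) with $S=S_n$, $Z_0=Q_n$, and a constant $\varepsilon$ as input. For each iteration $i=0,1,\dots$, until the stopping criterion $\|\delta_i\|_2\le\varepsilon$ is triggered, consider the following sequences of matrices, corresponding to each of the intermediate matrices occurring in either one or both of the two procedures: (a) $\{(Z_{i})_n\}$; (b) $\{(\delta_{i}^k)_n\}$, $k=1,2,\dots,m$; $\{(M_{i})_n\}$; $\{(SM_{i})_n\}$; $\{(Z_{i+1}^*(SM_{i}))_n\}$; $\{((M_{i}^*S)Z_{i})_n\}$. Assume that for any $R \geq 0$, there are constants $\gamma>0$ and $\beta > 0$ independent of $n$ such that $$|N_{d_n}(i,R)| \leq \gamma R^\beta$$ holds for all $i$. Assume that $S_n$ and $Q_n$ satisfy the exponential decay properties $$|[S_n]_{ij}| \leq ce^{-\alpha d_n(i,j)}, \qquad |[Q_n]_{ij}| \leq ce^{-\alpha d_n(i,j)}$$ for all $i,j=1,\dots,n$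 with constants $c>0$ and $\alpha>0$ independent of $n$. Assume also that the condition number of $S_n$, $\kappa_n = |\lambda_{\mathrm{max}}(S_n) / \lambda_{\mathrm{min}}(S_n)|$, is uniformly bounded with respect to $n$. Then, each of the matrices $X_n$ in (a) and (b) satisfies an exponential decay property of the form $$|[X_n]_{ij}| \leq c'e^{-\alpha' d_n(i,j)} \quad\text{for all } i,j$$ for any $\alpha'$ such that $0<\alpha'<\alpha$ with $c'$ independent of $n$. Besides this, each of the matrices $X_n$ in (b) also satisfies exponential decay away from the cut of the form $$|[X_n]_{ij}| \leq c'e^{-\alpha' \max (d^\mathrm{cut}_n(i),d^\mathrm{cut}_n(j))} \quad\text{for all } i,j$$ for any $\alpha'$ such that $0<\alpha'<\alpha$ with $c'$ independent of $n$.
   Context: Matrices are complex, $^*$ denotes the conjugate transpose, $\|\cdot\|_2$ is the spectral norm, and $\lambda_{\mathrm{min}}$, $\lambda_{\mathrm{max}}$ denote the smallest and largest eigenvalues. Each $d_n$ is a pseudometric on $\{1,\dots,n\}$: $d_n(i,j)\ge0$, $d_n(i,j)=d_n(j,i)$, $d_n(i,i)=0$, $d_n(i,j)\le d_n(i,k)+d_n(k,j)$. $N_{d_n}(i,R)=\{j: d_n(i,j)<R\}$ and $|\cdot|$ of a set is its cardinality. The block partition of $S_n$ corresponds to a binary partition of the index set $\{1,\dots,n\}$ into $I_{A_n}$ and $I_{C_n}=\{1,\dots,n\}\setminus I_{A_n}$ (the indices of the diagonal blocks $A_n$ and $C_n$), and the distance to the cut is $d_n^\mathrm{cut}(i) =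 \min_{k\in I_{A_n}} d_n(i,k) + \min_{k\in I_{C_n}} d_n(i,k)$. Let $m\ge1$ be an integer, $b_0 = 1$, and $b_k = \frac{2k-1}{2k}b_{k-1}$ for $k=1,\dots,m$. Regular iterative refinement (input $S=\begin{bmatrix} A & B \\ B^* & C \end{bmatrix}$, $Z_0=\begin{bmatrix} Z_A & 0 \\ 0 & Z_C \end{bmatrix}$, $\varepsilon$): set $\delta_0=I-Z_0^*SZ_0$; for $i=0,1,\dots$, while $\|\delta_i\|_2>\varepsilon$, set $Z_{i+1}=Z_i\sum_{k=0}^m b_k\delta_i^k$ and $\delta_{i+1}=I-Z_{i+1}^*SZ_{i+1}$; return the last $Z_i$. Localized iterative refinement (same input; mathematically equivalent): set $\delta_{0} = -\begin{bmatrix} 0 & Z_A^*BZ_C \\ Z_C^*B^*Z_A & 0 \end{bmatrix}$; for $i=0,1,\dots$, while $\|\delta_i\|_2>\varepsilon$, set $M_{i} = Z_{i} (\sum_{k=1}^m b_k\delta_{i}^k)$, $Z_{i+1} = Z_{i} + M_{i}$, $\delta_{i+1} = \delta_{i} - Z_{i+1}^*(SM_{i}) - (M_{i}^*S)Z_{i}$; return the last $Z_i$. $(Y)_n$ denotes the matrix $Y$ occurring when the input is $S_n$, $Q_n$, $\varepsilon$.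
   Formalization: The bound |N(i,R)| ≤ γR^β is assumed with γ, β independent of R as well as n, and only for R ≥ 1: if γ, β may depend on R the claim is false, and if they are uniform for all R > 0 the assumption is contradictory as R → 0. Also n ≥ 2 with both blocks nonempty. *)

(* Defs.v *)
From HB Require Import structures.
From mathcomp Require Import all_boot all_order all_algebra.
From mathcomp Require Import complex.
From mathcomp Require Import all_classical all_reals all_analysis.

Set Implicit Arguments.
Unset Strict Implicit.
Unset Printing Implicit Defensive.

Import Order.TTheory GRing.Theory Num.Theory.
Import ComplexField.Normc.
Local Open Scope ring_scope.
Local Open Scope complex_scope.
Local Open Scope classical_set_scope.
Local Open Scope sesquilinear_scope.

(* [normc z : R] is the modulus of [z : R[i]], [X ^t*] the conjugate transpose. *)

Definition vnorm2 (R : realType) (n : nat) (v : 'cV[R[i]]_n) : R :=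
  Num.sqrt (\sum_i normc (v i 0) ^+ 2).

Definition spectral_norm (R : realType) (n : nat) (X : 'M[R[i]]_n) : R :=
  sup [set vnorm2 (X *m v) | v in [set v : 'cV[R[i]]_n | vnorm2 v <= 1]].

Definition hermitian_posdef (R : realType) (n : nat) (S : 'M[R[i]]_n) : Prop :=
  S \is hermsymmx /\
  forall v : 'cV[R[i]]_n, v != 0 -> 0 < (v^t* *m S *m v) 0 0.

(* The set of real eigenvalues: for Hermitian [X] and [0 < n] it is the whole
   spectrum, finite and nonempty, so [sup] and [inf] are its max and min. *)
Definition real_spectrum (R : realType) (n : nat) (X : 'M[R[i]]_n) : set R :=
  [set x : R | eigenvalue X x%:C].

Definition lambda_max (R : realType) (n : nat) (X : 'M[R[i]]_n) : R :=
  sup (real_spectrum X).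

Definition lambda_min (R : realType) (n : nat) (X : 'M[R[i]]_n) : R :=
  inf (real_spectrum X).

Definition condition_number (R : realType) (n : nat) (X : 'M[R[i]]_n) : R :=
  `|lambda_max X / lambda_min X|.

Definition is_pseudometric (R : realType) (T : Type) (d : T -> T -> R) : Prop :=
  [/\ forall i j, 0 <= d i j,
      forall i j, d i j = d j i,
      forall i, d i i = 0 &
      forall i j k, d i j <= d i k + d k j].

Definition neighborhood (R : realType) (T : finType) (d : T -> T -> R)
    (i : T) (r : R) : {set T} := [set j | d i j < r]%SET.

(* Only radii [1 <= r] are constrained: since [i] always lies in its own
   neighborhood of radius [r > 0], no bound [gamma * r `^ beta] with constants
   independent of [r] can hold for [r] close to [0]. *)
Definition polynomial_growth (R : realType) (p q : nat -> nat)
    (d : forall n, 'I_(p n + q n) -> 'I_(p n + q n) -> R) : Prop :=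
  exists gamma beta : R, [/\ 0 < gamma, 0 < beta &
    forall n, (1 < n)%N -> forall (i : 'I_(p n + q n)) (r : R), 1 <= r ->
      #|neighborhood (d n) i r|%:R <= gamma * r `^ beta].

(* Index sets of the blocks: the ranges of [lshift q] and [rshift p]; for
   [p, q > 0] both infima are minima over finite nonempty sets. *)
Definition dcut (R : realType) (p q : nat) (d : 'I_(p + q) -> 'I_(p + q) -> R)
    (i : 'I_(p + q)) : R :=
  inf (range (fun k : 'I_p => d i (lshift q k))) +
  inf (range (fun k : 'I_q => d i (rshift p k))).

(* [P n] says that the matrix [X n] is present in the sequence. *)
Definition exp_decay (R : realType) (p q : nat -> nat) (P : nat -> Prop)
    (d : forall n, 'I_(p n + q n) -> 'I_(p n + q n) -> R) (c alpha : R)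
    (X : forall n, 'M[R[i]]_(p n + q n)) : Prop :=
  forall n, (1 < n)%N -> P n -> forall i j : 'I_(p n + q n),
    normc (X n i j) <= c * expR (- (alpha * d n i j)).

Definition cut_decay (R : realType) (p q : nat -> nat) (P : nat -> Prop)
    (d : forall n, 'I_(p n + q n) -> 'I_(p n + q n) -> R) (c alpha : R)
    (X : forall n, 'M[R[i]]_(p n + q n)) : Prop :=
  forall n, (1 < n)%N -> P n -> forall i j : 'I_(p n + q n),
    normc (X n i j)
      <= c * expR (- (alpha * Num.max (dcut (d n) i) (dcut (d n) j))).

Fixpoint bcoef (F : fieldType) (k : nat) : F :=
  if k is k'.+1 then (2 * k - 1)%:R / (2 * k)%:R * bcoef F k' else 1.

(* Both procedures are run on states [(Z_i, delta_i)], without the stopping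
   test, which is accounted for by [reached] below. *)
Definition reg_init (R : realType) (N : nat) (S Z0 : 'M[R[i]]_N) :
    'M[R[i]]_N * 'M[R[i]]_N := (Z0, 1%:M - Z0^t* *m S *m Z0).

Definition reg_step (R : realType) (m N : nat) (S : 'M[R[i]]_N)
    (s : 'M[R[i]]_N * 'M[R[i]]_N) : 'M[R[i]]_N * 'M[R[i]]_N :=
  let Z' := s.1 *m \sum_(0 <= k < m.+1) bcoef R[i] k *: s.2 ^+ k in
  (Z', 1%:M - Z'^t* *m S *m Z').

Definition regular (R : realType) (m N : nat) (S Z0 : 'M[R[i]]_N) (i : nat) :
    'M[R[i]]_N * 'M[R[i]]_N := iter i (reg_step m S) (reg_init S Z0).

Definition loc_init (R : realType) (p q : nat) (S Z0 : 'M[R[i]]_(p + q)) :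
    'M[R[i]]_(p + q) * 'M[R[i]]_(p + q) :=
  let B := ursubmx S in let ZA := ulsubmx Z0 in let ZC := drsubmx Z0 in
  (Z0, - block_mx 0 (ZA^t* *m B *m ZC) (ZC^t* *m B^t* *m ZA) 0).

Definition loc_M (R : realType) (m N : nat)
    (s : 'M[R[i]]_N * 'M[R[i]]_N) : 'M[R[i]]_N :=
  s.1 *m \sum_(1 <= k < m.+1) bcoef R[i] k *: s.2 ^+ k.

Definition loc_step (R : realType) (m N : nat) (S : 'M[R[i]]_N)
    (s : 'M[R[i]]_N * 'M[R[i]]_N) : 'M[R[i]]_N * 'M[R[i]]_N :=
  let M := loc_M m s in
  let Z' := s.1 + M in
  (Z', s.2 - Z'^t* *m (S *m M) - (M^t* *m S) *m s.1).

Definition localized (R : realType) (m p q : nat) (S Z0 : 'M[R[i]]_(p + q))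
    (i : nat) : 'M[R[i]]_(p + q) * 'M[R[i]]_(p + q) :=
  iter i (loc_step m S) (loc_init S Z0).

(* The while loop with tolerance [eps] computes [(Z_i, delta_i)]; its body is
   executed for the index [i] exactly when [reached eps run i.+1]. *)
Definition reached (R : realType) (N : nat) (eps : R)
    (run : nat -> 'M[R[i]]_N * 'M[R[i]]_N) (i : nat) : Prop :=
  forall l, (l < i)%N -> eps < spectral_norm (run l).2.

(* Main.v *)
(** For a fixed iteration index every intermediate matrix is a fixed polynomial
in S, Q and Q^*.  Matrices decaying at every rate below alpha form a
*-algebra: polynomial growth makes the sums of exp(-theta d(i,k)) over k
uniformly bounded for every theta > 0, so a product decays at any slightly
smaller rate.  Since dcut is 1-Lipschitz for d, the matrices that moreover decay
away from the cut form a two-sided *-ideal.  The residual delta_0 vanishes on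
the diagonal blocks, and dcut(i), dcut(j) <= d(i,j) across the cut, so delta_0
lies in this ideal; with M = Z (b_1 delta + ... + b_m delta^m), the updates
  delta' = delta - Z'^* (S M) - (M^* S) Z    (localized)
         = delta - Z^* (S M) - M^* (S Z')    (regular)
keep it there. *)
Require Import Defs.
From HB Require Import structures.
From mathcomp Require Import all_boot all_order all_algebra.
From mathcomp Require Import complex.
From mathcomp Require Import all_classical all_reals all_analysis.
From mathcomp Require Import ring lra.

Set Implicit Arguments.
Unset Strict Implicit.
Unset Printing Implicit Defensive.

Import Order.TTheory GRing.Theory Num.Theory.
Local Open Scope ring_scope.
Local Open Scope complex_scope.
Local Open Scope sesquilinear_scope.

(** * Moduli and conjugate transposes *)

Lemma normc_ge0 (R : realType) (z : R[i]) : 0 <= ComplexField.Normc.normc z.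
Proof. by case: z => a b; exact: sqrtr_ge0. Qed.

Lemma normc_conjC (R : realType) (z : R[i]) :
  ComplexField.Normc.normc z^*%R = ComplexField.Normc.normc z.
Proof. by apply: (@complexI R); exact: (@norm_conjC R[i] z). Qed.

Lemma ler_normc_sum (R : realType) (I : Type) (r : seq I) (F : I -> R[i]) :
  ComplexField.Normc.normc (\sum_(k <- r) F k)
    <= \sum_(k <- r) ComplexField.Normc.normc (F k).
Proof.
elim/big_ind2: _ => [|x y z t hx hz|//]; first by rewrite ComplexField.Normc.normc0.
exact: le_trans (le_normcD _ _) (lerD hx hz).
Qed.

Lemma trmxC_mul (C : numClosedFieldType) (a b e : nat)
    (X : 'M[C]_(a, b)) (Y : 'M[C]_(b, e)) : (X *m Y)^t* = Y^t* *m X^t*.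
Proof. by rewrite trmx_mul map_mxM. Qed.

(** * Uniform summability of exponentials under polynomial growth *)

(** Applying [ln x < x] at [x = t / b * u] gives [b * ln u <= t * u - b * ln (t / b)];
    exponentiating yields the constant. *)
Lemma powR_le_expR (R : realType) (b t : R) : 0 < b -> 0 < t ->
  exists2 K : R, 0 < K & forall u : R, 0 < u -> u `^ b <= K * expR (t * u).
Proof.
move=> b0 t0; have s0 : 0 < t / b by rewrite divr_gt0.
exists (expR (- (b * ln (t / b)))) => [|u u0]; first exact: expR_gt0.
rewrite /powR gt_eqF// -expRD ler_expR.
have := ltW (ln_sublinear (mulr_gt0 s0 u0)).
rewrite (lnM s0 u0) -(ler_pM2l b0) mulrDr => h.
have -> : t * u = b * (t / b * u) by field; rewrite gt_eqF.
lra.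
Qed.

(* Shells [t <= d i j < t + 1] contribute at most [expR (- theta t)] per
   point, and the number of their points grows only polynomially in [t]. *)
Lemma sum_expR_bound (R : realType) (p q : nat -> nat)
    (d : forall n, 'I_(p n + q n) -> 'I_(p n + q n) -> R) (theta : R) :
  (forall n, (1 < n)%N -> forall i j, 0 <= d n i j) ->
  polynomial_growth d -> 0 < theta ->
  exists2 K : R, 0 < K & forall n, (1 < n)%N -> forall i : 'I_(p n + q n),
    \sum_j expR (- (theta * d n i j)) <= K.
Proof.
move=> d_ge0 [g [b [g0 b0 growth]]] th0.
have th20 : 0 < theta / 2 by rewrite divr_gt0.
have [K0 K00 hK0] := powR_le_expR b0 th20.
pose r := expR (- (theta / 2)).
have r0 : 0 < r by exact: expR_gt0.
have r1 : r < 1 by rewrite expR_lt1 oppr_lt0.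
(* Half of [theta] absorbs the polynomial count, [(t + 1) ^ b <= K0 * exp (theta / 2 * (t + 1))];
   the other half is left as the ratio [r] of a geometric series. *)
exists (g * K0 * expR (theta / 2) / (1 - r)).
  by rewrite divr_gt0 ?subr_gt0// !mulr_gt0// expR_gt0.
move=> n n1 i.
pose tr j := Num.truncn (d n i j).
pose T := (\max_j tr j).+1.
(* The indicator is that of the ball of radius [t + 1], whose size the growth hypothesis bounds
   directly since [t + 1 >= 1]. Only the term [t = tr j] of the sum is used, and [T] exceeds every
   [tr j]. *)
have shell j : expR (- (theta * d n i j)) <=
    \sum_(0 <= t < T) (d n i j < t.+1%:R)%R%:R * expR (- (theta * t%:R)).
  have /andP[lo hi] := truncn_itv (d_ge0 n n1 i j).
  have trT : (tr j < T)%N by rewrite ltnS; exact: (@leq_bigmax _ tr j).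
  rewrite big_mkord (bigD1 (Ordinal trT)) //= hi mul1r.
  rewrite -[leLHS]addr0 lerD ?ler_expR ?lerN2 ?ler_pM2l//.
  by apply: sumr_ge0 => t _; rewrite mulr_ge0 ?expR_ge0.
apply: le_trans (ler_sum _ (fun j _ => shell j)) _.
rewrite exchange_big /=.
have term t : \sum_j (d n i j < t.+1%:R)%R%:R * expR (- (theta * t%:R))
    <= g * K0 * expR (theta / 2) * r ^+ t.
  rewrite -mulr_suml.
  have -> : \sum_j (d n i j < t.+1%:R)%R%:R = #|neighborhood (d n) i t.+1%:R|%:R :> R.
    rewrite -sum1_card natr_sum [RHS]big_mkcond /=; apply: eq_bigr => j _.
    by rewrite inE; case: ifP.
  apply: (@le_trans _ _ (g * (K0 * expR (theta / 2 * t.+1%:R))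
      * expR (- (theta * t%:R)))).
    rewrite ler_pM2r ?expR_gt0//; apply: le_trans (growth n n1 i _ _) _.
      by rewrite ler1n.
    by rewrite ler_pM2l// hK0.
  rewrite /r -expRM_natr -!mulrA -!expRD !ler_pM2l// ler_expR.
  by rewrite -(natr1 t); lra.
apply: le_trans (ler_sum _ (fun t _ => term t)) _.
rewrite -mulr_sumr -mulrA ler_pM2l ?mulr_gt0 ?expR_gt0//.
have := @geometric_le_lim R T 1 r ler01 r0.
rewrite (ger0_norm (ltW r0)) mul1r => /(_ r1).
by rewrite /series /=; under eq_bigr do rewrite mul1r.
Qed.

(** * The algebra of families decaying at every rate below [alpha] *)

(** Products lose an arbitrarily small amount of rate, so quantifying over all smaller rates gives a
    class closed under multiplication. The weight is left free to cover both the distance and the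
    cut. *)
Definition decays_below (R : realType) (p q : nat -> nat)
    (w : forall n, 'I_(p n + q n) -> 'I_(p n + q n) -> R) (alpha : R)
    (X : forall n, 'M[R[i]]_(p n + q n)) : Prop :=
  forall a, 0 < a < alpha -> exists2 c, 0 < c & exp_decay (fun=> True) w c a X.

Section DecaysBelow.
Variables (R : realType) (p q : nat -> nat) (alpha : R).
Notation weight := (forall n, 'I_(p n + q n) -> 'I_(p n + q n) -> R).
Notation mxfamily := (forall n, 'M[R[i]]_(p n + q n)).
Implicit Types (w d : weight) (X Y : mxfamily).

(** Zero entries satisfy any bound, so weights are compared only at the others. With [w' = w] this
    transports decay along entrywise equalities known only for [1 < n]. *)
Lemma decays_below_le w w' X Y :
  (forall n, (1 < n)%N -> forall i j, Y n i j = 0 \/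
     w' n i j <= w n i j /\ Y n i j = X n i j) ->
  decays_below w alpha X -> decays_below w' alpha Y.
Proof.
move=> h decX a aal; have [c c0 hX] := decX a aal; exists c => // n n1 _ i j.
have [-> | [ww ->]] := h n n1 i j.
  by rewrite ComplexField.Normc.normc0 mulr_ge0 ?expR_ge0 ?ltW.
apply: le_trans (hX n n1 I i j) _; have /andP[a0 _] := aal.
by rewrite ler_pM2l// ler_expR lerN2 ler_pM2l.
Qed.

Lemma exp_decay_below d c X :
  (forall n, (1 < n)%N -> forall i j, 0 <= d n i j) -> 0 < c ->
  exp_decay (fun=> True) d c alpha X -> decays_below d alpha X.
Proof.
move=> d0 c0 hX a /andP[a0 aal]; exists c => // n n1 _ i j.
apply: le_trans (hX n n1 I i j) _.
by rewrite ler_pM2l// ler_expR lerN2 ler_wpM2r ?d0 ?ltW.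
Qed.

Lemma decays_below1 d : (forall n, (1 < n)%N -> forall i, d n i i = 0) ->
  decays_below d alpha (fun=> 1%:M).
Proof.
move=> d0 a _; exists 1 => // n n1 _ i j; rewrite mxE mul1r.
have [->|_] := eqVneq i j; last first.
  by rewrite ComplexField.Normc.normc0 expR_ge0.
by rewrite d0// mulr0 oppr0 expR0 ComplexField.Normc.normc1.
Qed.

Lemma decays_below0 w : decays_below w alpha (fun=> 0).
Proof.
move=> a _; exists 1 => // n n1 _ i j.
by rewrite mxE ComplexField.Normc.normc0 mul1r expR_ge0.
Qed.

Lemma decays_belowD w X Y : decays_below w alpha X -> decays_below w alpha Y ->
  decays_below w alpha (fun n => X n + Y n).
Proof.
move=> decX decY a aal.
have [c c0 hX] := decX a aal; have [e e0 hY] := decY a aal.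
exists (c + e) => [|n n1 _ i j]; first exact: addr_gt0.
rewrite mxE mulrDl; apply: le_trans (le_normcD _ _) _.
by rewrite lerD ?hX ?hY.
Qed.

Lemma decays_belowZ w (b : R[i]) X : decays_below w alpha X ->
  decays_below w alpha (fun n => b *: X n).
Proof.
move=> decX a aal; have [c c0 hX] := decX a aal.
have b0 := normc_ge0 b.
(* The [+ 1] keeps the constant positive when [b = 0]. *)
exists ((ComplexField.Normc.normc b + 1) * c) => [|n n1 _ i j].
  by rewrite mulr_gt0// ltr_wpDl.
rewrite mxE ComplexField.Normc.normcM -mulrA.
by rewrite ler_pM ?normc_ge0 ?lerDl ?hX.
Qed.

Lemma decays_belowB w X Y : decays_below w alpha X -> decays_below w alpha Y ->
  decays_below w alpha (fun n => X n - Y n).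
Proof.
move=> decX decY; have := decays_belowD decX (decays_belowZ (-1) decY).
by apply: decays_below_le => n n1 i j; right; split; rewrite ?scaleN1r.
Qed.

Lemma decays_below_sum w (a b : nat) (F : nat -> mxfamily) :
  (forall k, (a <= k < b)%N -> decays_below w alpha (F k)) ->
  decays_below w alpha (fun n => \sum_(a <= k < b) F k n).
Proof.
elim: b => [|b IH] hF.
  apply: decays_below_le (@decays_below0 w) => n n1 i j; right; split => //.
  by rewrite big_geq.
have [ab|ba] := leqP a b; last first.
  apply: decays_below_le (@decays_below0 w) => n n1 i j; right; split => //.
  by rewrite big_geq.
have h : decays_below w alpha (fun n => \sum_(a <= k < b) F k n).
  by apply: IH => k /andP[ak kb]; apply: hF; rewrite ak ltnW.
have hb : decays_below w alpha (F b) by apply: hF; rewrite ab ltnS leqnn.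
apply: decays_below_le (decays_belowD h hb) => n n1 i j; right; split => //.
by rewrite big_nat_recr.
Qed.

Lemma decays_belowC w X :
  (forall n, (1 < n)%N -> forall i j, w n i j = w n j i) ->
  decays_below w alpha X -> decays_below w alpha (fun n => (X n)^t*).
Proof.
move=> wC decX a aal; have [c c0 hX] := decX a aal.
by exists c => // n n1 _ i j; rewrite !mxE normc_conjC wC// hX.
Qed.

(* The rate lost is what makes the sum over the intermediate index converge. *)
Lemma decays_belowM w d X Y :
  (forall n, (1 < n)%N -> is_pseudometric (d n)) -> polynomial_growth d ->
  (forall n, (1 < n)%N -> forall i j k, w n i j <= w n i k + d n k j) ->
  decays_below w alpha X -> decays_below d alpha Y ->
  decays_below w alpha (fun n => X n *m Y n).
Proof.
move=> d_pm growth wd decX decY a aal.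
have [c c0 hX] := decX a aal; have /andP[a0 a_lt] := aal.
(* [Y] is taken at the midpoint rate, which exceeds [a] by [(alpha - a) / 2]. The part [a] is spent
   on [wd] to recover [w n i j]; the surplus makes the sum over [k] bounded. *)
have [e e0 hY] : exists2 e, 0 < e & exp_decay (fun=> True) d e ((a + alpha) / 2) Y.
  by apply: decY; lra.
have d0 n : (1 < n)%N -> forall i j, 0 <= d n i j by move=> /d_pm[].
have th0 : 0 < (a + alpha) / 2 - a by lra.
have [K K0 hK] := sum_expR_bound d0 growth th0.
exists (c * e * K) => [|n n1 _ i j]; first by rewrite !mulr_gt0.
rewrite mxE; apply: le_trans (ler_normc_sum _ _) _.
have term k : ComplexField.Normc.normc (X n i k * Y n k j)
    <= c * e * expR (- (a * w n i j))
       * expR (- (((a + alpha) / 2 - a) * d n j k)).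
  rewrite ComplexField.Normc.normcM.
  apply: le_trans (ler_pM (normc_ge0 _) (normc_ge0 _) (hX n n1 I i k) (hY n n1 I k j)) _.
  have [_ dC _ _] := d_pm n n1; rewrite (dC j k).
  rewrite mulrACA -[leRHS]mulrA ler_pM2l ?mulr_gt0// -!expRD ler_expR.
  have := wd n n1 i j k; rewrite -(ler_pM2l a0); nra.
apply: le_trans (ler_sum _ (fun k _ => term k)) _.
rewrite -mulr_sumr -!mulrA !ler_pM2l// mulrC ler_pM2r ?expR_gt0//.
exact: hK.
Qed.

End DecaysBelow.

(** * Distance to the cut *)

Section DistanceToCut.
Variables (R : realType) (T : Type) (d : T -> T -> R).
Hypothesis d_pm : is_pseudometric d.

Lemma inf_dist_ge0 (U : Type) (f : U -> T) (k0 : U) i :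
  0 <= inf (range (fun k => d i (f k))).
Proof.
have [d0 _ _ _] := d_pm.
by apply: lb_le_inf => [|_ [k _ <-]//]; exists (d i (f k0)), k0.
Qed.

Lemma inf_dist_le (U : Type) (f : U -> T) (k : U) i :
  inf (range (fun k => d i (f k))) <= d i (f k).
Proof.
have [d0 _ _ _] := d_pm.
by apply: ge_inf; [exists 0 => _ [l _ <-] | exists k].
Qed.

Lemma inf_dist_image (U : Type) (f : U -> T) (k : U) :
  inf (range (fun l => d (f k) (f l))) = 0.
Proof.
have [_ _ dd _] := d_pm.
by apply/eqP; rewrite eq_le inf_dist_ge0// andbT -(dd (f k)) inf_dist_le.
Qed.

Lemma inf_dist_lipschitz (U : Type) (f : U -> T) (k0 : U) i j :
  inf (range (fun k => d i (f k))) <= inf (range (fun k => d j (f k))) + d j i.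
Proof.
have [_ dC _ dt] := d_pm.
rewrite -lerBlDr; apply: lb_le_inf => [|_ [k _ <-]]; first by exists (d j (f k0)), k0.
rewrite lerBlDr; apply: le_trans (inf_dist_le f k i) _.
by rewrite addrC (dC j i) dt.
Qed.

End DistanceToCut.

(** The infimum over a point's own block is zero, and the other one is at most the distance to the
    chosen point of the opposite block. *)
Lemma dcut_cross (R : realType) (p q : nat) (d : 'I_(p + q) -> 'I_(p + q) -> R)
    (k : 'I_p) (l : 'I_q) : is_pseudometric d ->
  dcut d (lshift q k) <= d (lshift q k) (rshift p l) /\
  dcut d (rshift p l) <= d (lshift q k) (rshift p l).
Proof.
move=> d_pm; have [_ dC _ _] := d_pm; split; rewrite /dcut.
  by rewrite inf_dist_image// add0r inf_dist_le.
by rewrite (inf_dist_image d_pm (@rshift p q)) addr0 dC inf_dist_le.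
Qed.

(* One of the two infima vanishes at each index, which is why the
   Lipschitz constant is 1 rather than 2. *)
Lemma dcut_lipschitz (R : realType) (p q : nat)
    (d : 'I_(p + q) -> 'I_(p + q) -> R) i j :
  is_pseudometric d -> (0 < p)%N -> (0 < q)%N -> dcut d i <= dcut d j + d j i.
Proof.
move=> d_pm p0 q0; have [_ dC _ _] := d_pm.
case: (split_ordP i) => k ->; case: (split_ordP j) => l ->.
- rewrite /dcut !(inf_dist_image d_pm (@lshift p q)) !add0r.
  exact: inf_dist_lipschitz (Ordinal q0) _ _.
(* In opposite blocks [dcut d i] is already at most [d j i], and [dcut d j] is nonnegative. *)
- have [h _] := dcut_cross k l d_pm; apply: le_trans h _; rewrite dC lerDr.
  by rewrite addr_ge0// inf_dist_ge0//; exact: Ordinal.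
- have [_ h] := dcut_cross l k d_pm; apply: le_trans h _; rewrite lerDr.
  by rewrite addr_ge0// inf_dist_ge0//; exact: Ordinal.
- rewrite /dcut !(inf_dist_image d_pm (@rshift p q)) !addr0.
  exact: inf_dist_lipschitz (Ordinal p0) _ _.
Qed.

(** * Algebraic identities for the two iterations *)

(** Since [b_0 = 1], the term of index 0 contributes [s.1]; the regular update thus has the same
    form [Z + M] as the localized one. *)
Lemma reg_step1 (R : realType) (m N : nat) (S : 'M[R[i]]_N)
    (s : 'M[R[i]]_N * 'M[R[i]]_N) : (reg_step m S s).1 = s.1 + loc_M m s.
Proof.
by rewrite /reg_step /loc_M /= big_ltn// expr0 scale1r mulmxDr mulmx1.
Qed.

Lemma regular_residual (R : realType) (m N : nat) (S Z0 : 'M[R[i]]_N) (l : nat) :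
  (regular m S Z0 l).2 =
    1%:M - (regular m S Z0 l).1^t* *m S *m (regular m S Z0 l).1.
Proof. by case: l. Qed.

(** Expanding [Z' = Z + M] in the new residual makes [1 - Z^* S Z] reappear as the old one, and
    every remaining term contains [M]. This exhibits the decay away from the cut, which the defining
    formula hides. *)
Lemma reg_step2 (R : realType) (m N : nat) (S : 'M[R[i]]_N)
    (s : 'M[R[i]]_N * 'M[R[i]]_N) : s.2 = 1%:M - s.1^t* *m S *m s.1 ->
  (reg_step m S s).2 = s.2 - s.1^t* *m (S *m loc_M m s)
    - (loc_M m s)^t* *m (S *m (s.1 + loc_M m s)).
Proof.
move=> ->; have -> : (reg_step m S s).2 =
  1%:M - (reg_step m S s).1^t* *m S *m (reg_step m S s).1 by [].
rewrite reg_step1 [(_ + _)^T]linearD /= map_mxD -mulmxA mulmxDl.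
by rewrite [in X in 1%:M - (X + _)]mulmxDr mulmxDr !opprD !addrA !mulmxA.
Qed.

(** The normalisations of [ZA] and [ZC] cancel the identity on the diagonal blocks, leaving the
    initial residual of the localized procedure. *)
Lemma reg_init_block (R : realType) (p q : nat) (A ZA : 'M[R[i]]_p)
    (C ZC : 'M[R[i]]_q) (B : 'M[R[i]]_(p, q)) :
  ZA^t* *m A *m ZA = 1%:M -> ZC^t* *m C *m ZC = 1%:M ->
  (reg_init (block_mx A B (B^t*) C) (block_mx ZA 0 0 ZC)).2 =
    - block_mx 0 (ZA^t* *m B *m ZC) (ZC^t* *m B^t* *m ZA) 0.
Proof.
move=> hA hC; rewrite /reg_init /= tr_block_mx map_block_mx !trmx0 !map_mx0.
rewrite !mulmx_block !(mul0mx, mulmx0, addr0, add0r) hA hC.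
by rewrite scalar_mx_block !opp_block_mx add_block_mx !(subrr, oppr0, add0r).
Qed.

Lemma loc_init_block (R : realType) (p q : nat) (A ZA : 'M[R[i]]_p)
    (C ZC : 'M[R[i]]_q) (B : 'M[R[i]]_(p, q)) :
  (loc_init (block_mx A B (B^t*) C) (block_mx ZA 0 0 ZC)).2 =
    - block_mx 0 (ZA^t* *m B *m ZC) (ZC^t* *m B^t* *m ZA) 0.
Proof. by rewrite /loc_init /= block_mxKur block_mxKul block_mxKdr. Qed.

(** * The ideal of families decaying away from the cut *)

(** This makes [cut_decay] an instance of decay for a weight. The weight need not vanish on the
    diagonal, so the identity need not decay uniformly. *)
Definition cut_weight (R : realType) (p q : nat -> nat)
    (d : forall n, 'I_(p n + q n) -> 'I_(p n + q n) -> R)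
    (n : nat) (i j : 'I_(p n + q n)) : R :=
  Num.max (dcut (d n) i) (dcut (d n) j).

(** The two decays are kept together because in a product such as a power of the residual one factor
    is used through its ordinary decay. *)
Definition decays_to_cut (R : realType) (p q : nat -> nat)
    (d : forall n, 'I_(p n + q n) -> 'I_(p n + q n) -> R) (alpha : R)
    (X : forall n, 'M[R[i]]_(p n + q n)) : Prop :=
  decays_below d alpha X /\ decays_below (cut_weight d) alpha X.

Section DecaysToCut.
Variables (R : realType) (p q : nat -> nat).
Variables (d : forall n, 'I_(p n + q n) -> 'I_(p n + q n) -> R) (alpha : R).
Arguments d : clear implicits.
Hypothesis p_gt0 : forall n, (1 < n)%N -> (0 < p n)%N.
Hypothesis q_gt0 : forall n, (1 < n)%N -> (0 < q n)%N.
Hypothesis d_pm : forall n, (1 < n)%N -> is_pseudometric (d n).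
Hypothesis d_growth : polynomial_growth d.
Implicit Types X Y Z D : forall n, 'M[R[i]]_(p n + q n).

Let decM X Y : decays_below d alpha X -> decays_below d alpha Y ->
  decays_below d alpha (fun n => X n *m Y n).
Proof.
by apply: decays_belowM => // n n1 i j k; have [] := d_pm n1.
Qed.

Let decC X : decays_below d alpha X -> decays_below d alpha (fun n => (X n)^t*).
Proof. by apply: decays_belowC => n n1 i j; have [] := d_pm n1. Qed.

Lemma decays_to_cutB X Y : decays_to_cut d alpha X -> decays_to_cut d alpha Y ->
  decays_to_cut d alpha (fun n => X n - Y n).
Proof. by move=> [? ?] [? ?]; split; apply: decays_belowB. Qed.

Lemma decays_to_cutC X : decays_to_cut d alpha X ->
  decays_to_cut d alpha (fun n => (X n)^t*).
Proof.
move=> [dX cX]; split; first exact: decC.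
by apply: decays_belowC cX => n n1 i j; exact: maxC.
Qed.

(** Moving the second index from [k] to [j] raises [dcut] by at most [d n k j], which is the
    compatibility of weights that [decays_belowM] asks for. *)
Lemma decays_to_cutMr X Y : decays_to_cut d alpha X -> decays_below d alpha Y ->
  decays_to_cut d alpha (fun n => X n *m Y n).
Proof.
move=> [dX cX] dY; split; first exact: decM.
apply: decays_belowM dY => // n n1 i j k; have [d0 _ _ _] := d_pm n1.
rewrite /cut_weight ge_max; apply/andP; split.
  by rewrite -[leLHS]addr0 lerD// le_max lexx.
apply: le_trans (dcut_lipschitz j k (d_pm n1) (p_gt0 n1) (q_gt0 n1)) _.
by rewrite lerD2r le_max lexx orbT.
Qed.

(** Conjugate transposition preserves both classes and swaps the factors, reducing this to
    multiplication on the right. *)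
Lemma decays_to_cutMl X Y : decays_below d alpha X -> decays_to_cut d alpha Y ->
  decays_to_cut d alpha (fun n => X n *m Y n).
Proof.
move=> dX gY.
have -> : (fun n => X n *m Y n) = (fun n => ((Y n)^t* *m (X n)^t*)^t*).
  by apply: functional_extensionality_dep => n; rewrite trmxC_mul !trmxCK.
exact: decays_to_cutC (decays_to_cutMr (decays_to_cutC gY) (decC dX)).
Qed.

Lemma decays_to_cutX D k : (0 < k)%N -> decays_to_cut d alpha D ->
  decays_to_cut d alpha (fun n => D n ^+ k).
Proof.
move=> + gD; elim: k => [//|[//|k IH _]].
exact: decays_to_cutMr gD (IH isT).1.
Qed.

(** The sum starts at [k = 1]: a polynomial in [D] without constant term stays in the ideal. *)
Lemma decays_to_cut_loc_M m Z D : decays_below d alpha Z ->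
  decays_to_cut d alpha D -> decays_to_cut d alpha (fun n => loc_M m (Z n, D n)).
Proof.
move=> dZ gD; apply: decays_to_cutMl => //.
split; apply: decays_below_sum => k /andP[k0 _]; apply: decays_belowZ.
  exact: (decays_to_cutX k0 gD).1.
exact: (decays_to_cutX k0 gD).2.
Qed.

Lemma decays_to_cut_offdiag X :
  (forall n, (1 < n)%N -> ulsubmx (X n) = 0 /\ drsubmx (X n) = 0) ->
  decays_below d alpha X -> decays_to_cut d alpha X.
Proof.
move=> X0 dX; split=> //; apply: decays_below_le dX => n n1 i j.
have [/matrixP ul /matrixP dr] := X0 n n1; have [_ dC _ _] := d_pm n1.
case: (split_ordP i) => k ->; case: (split_ordP j) => l ->.
- by left; have := ul k l; rewrite !mxE.
- right; split=> //; have [h h'] := dcut_cross k l (d_pm n1).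
  by rewrite /cut_weight ge_max h h'.
- right; split=> //; have [h h'] := dcut_cross l k (d_pm n1).
  by rewrite /cut_weight ge_max dC h h'.
- by left; have := dr k l; rewrite !mxE.
Qed.

(** * Induction along the two runs *)

Section Runs.
Variables (m : nat) (S Q : forall n, 'M[R[i]]_(p n + q n)).
Arguments S : clear implicits.
Arguments Q : clear implicits.
Hypothesis delta0_reg : forall n, (1 < n)%N ->
  ulsubmx (reg_init (S n) (Q n)).2 = 0 /\ drsubmx (reg_init (S n) (Q n)).2 = 0.
Hypothesis delta0_loc : forall n, (1 < n)%N ->
  (loc_init (S n) (Q n)).2 = (reg_init (S n) (Q n)).2.
Hypothesis dS : decays_below d alpha S.
Hypothesis dQ : decays_below d alpha Q.

(** Ordinary decay is read off from [1 - Q^* S Q]; the vanishing diagonal blocks upgrade it to decay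
    away from the cut. *)
Let decays_delta0 : decays_to_cut d alpha (fun n => (reg_init (S n) (Q n)).2).
Proof.
apply: decays_to_cut_offdiag => //; apply: decays_belowB.
  by apply: decays_below1 => n n1 i; have [_ _] := d_pm n1.
exact: decM (decM (decC dQ) dS) dQ.
Qed.

Lemma localized_decays l :
  decays_below d alpha (fun n => (localized m (S n) (Q n) l).1) /\
  decays_to_cut d alpha (fun n => (localized m (S n) (Q n) l).2).
Proof.
elim: l => [|l [dZ gD]].
  split; first exact: dQ.
  (* The initial residuals are known to agree only for [1 < n], so decay is transferred entrywise
     instead of rewriting the family. *)
  have [dD cD] := decays_delta0.
  by split; [move: dD | move: cD]; apply: decays_below_le => n n1 i j;
    right; split; rewrite ?delta0_loc.
have gM := decays_to_cut_loc_M m dZ gD.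
have dZ' := decays_belowD dZ gM.1; split; first exact: dZ'.
apply: decays_to_cutB; first apply: decays_to_cutB => //.
  exact: decays_to_cutMl (decC dZ') (decays_to_cutMl dS gM).
exact: decays_to_cutMr (decays_to_cutMr (decays_to_cutC gM) dS) dZ.
Qed.

Lemma regular_decays l :
  decays_below d alpha (fun n => (regular m (S n) (Q n) l).1) /\
  decays_to_cut d alpha (fun n => (regular m (S n) (Q n) l).2).
Proof.
elim: l => [|l [dZ gD]]; first by split; [exact: dQ | exact: decays_delta0].
have gM := decays_to_cut_loc_M m dZ gD.
have dZ' := decays_belowD dZ gM.1.
(* The step identities hold for every [n], so here whole families can be rewritten. *)
have -> : (fun n => (regular m (S n) (Q n) l.+1).1) = (fun n =>
    (regular m (S n) (Q n) l).1 + loc_M m (regular m (S n) (Q n) l)).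
  by apply: functional_extensionality_dep => n; exact: reg_step1.
have -> : (fun n => (regular m (S n) (Q n) l.+1).2) = (fun n =>
    let s := regular m (S n) (Q n) l in
    s.2 - s.1^t* *m (S n *m loc_M m s)
      - (loc_M m s)^t* *m (S n *m (s.1 + loc_M m s))).
  apply: functional_extensionality_dep => n; apply: reg_step2.
  exact: regular_residual.
split; first by move: dZ'; apply: decays_below_le => n n1 i j; right.
apply: decays_to_cutB; first apply: decays_to_cutB => //.
  exact: decays_to_cutMl (decC dZ) (decays_to_cutMl dS gM).
exact: decays_to_cutMr (decays_to_cutC gM) (decM dS dZ').
Qed.

End Runs.
End DecaysToCut.

Theorem theorem5p6 (R : realType) (m : nat) (eps : R) (p q : nat -> nat)
    (S Q : forall n, 'M[R[i]]_(p n + q n))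
    (A : forall n, 'M[R[i]]_(p n)) (B : forall n, 'M[R[i]]_(p n, q n))
    (C : forall n, 'M[R[i]]_(q n))
    (ZA : forall n, 'M[R[i]]_(p n)) (ZC : forall n, 'M[R[i]]_(q n))
    (d : forall n, 'I_(p n + q n) -> 'I_(p n + q n) -> R)
    (c alpha : R)
    (m_ge1 : (1 <= m)%N)
    (sizes : forall n, (1 < n)%N ->
       [/\ (0 < p n)%N, (0 < q n)%N & (p n + q n)%N = n])
    (d_pm : forall n, (1 < n)%N -> is_pseudometric (d n))
    (S_hpd : forall n, (1 < n)%N -> hermitian_posdef (S n))
    (S_block : forall n, (1 < n)%N ->
       S n = block_mx (A n) (B n) ((B n)^t*) (C n))
    (Q_block : forall n, (1 < n)%N -> Q n = block_mx (ZA n) 0 0 (ZC n))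
    (ZA_inv : forall n, (1 < n)%N -> (ZA n)^t* *m A n *m ZA n = 1%:M)
    (ZC_inv : forall n, (1 < n)%N -> (ZC n)^t* *m C n *m ZC n = 1%:M)
    (d_growth : polynomial_growth d)
    (c_gt0 : 0 < c) (alpha_gt0 : 0 < alpha)
    (S_decay : exp_decay (fun=> True) d c alpha S)
    (Q_decay : exp_decay (fun=> True) d c alpha Q)
    (S_cond : exists K : R, forall n, (1 < n)%N -> condition_number (S n) <= K) :
  let reg n := regular m (S n) (Q n) in
  let loc n := localized m (S n) (Q n) in
  forall (i : nat) (alpha' : R), 0 < alpha' < alpha ->
  let reg_reached l := fun n => reached eps (reg n) l in
  let loc_reached l := fun n => reached eps (loc n) l in
  let decay P X := exists2 c' : R, 0 < c' & exp_decay P d c' alpha' X in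
  let decay_and_cut P X := decay P X /\
    exists2 c' : R, 0 < c' & cut_decay P d c' alpha' X in
  let M n := loc_M m (loc n i) in
  [/\ decay (reg_reached i) (fun n => (reg n i).1) /\
      decay (loc_reached i) (fun n => (loc n i).1),
      forall k, (1 <= k <= m)%N ->
        decay_and_cut (reg_reached i) (fun n => (reg n i).2 ^+ k) /\
        decay_and_cut (loc_reached i) (fun n => (loc n i).2 ^+ k),
      decay_and_cut (loc_reached i.+1) M,
      decay_and_cut (loc_reached i.+1) (fun n => S n *m M n) &
      decay_and_cut (loc_reached i.+1)
        (fun n => (loc n i.+1).1^t* *m (S n *m M n)) /\
      decay_and_cut (loc_reached i.+1)
        (fun n => ((M n)^t* *m S n) *m (loc n i).1)].

Proof.
move=> reg loc l a aal reg_reached loc_reached decay decay_and_cut M.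
have p0 n : (1 < n)%N -> (0 < p n)%N by case/sizes.
have q0 n : (1 < n)%N -> (0 < q n)%N by case/sizes.
have d0 n : (1 < n)%N -> forall i j, 0 <= d n i j by move=> /d_pm[].
have dS := exp_decay_below d0 c_gt0 S_decay.
have dQ := exp_decay_below d0 c_gt0 Q_decay.
have delta0 n (n1 : (1 < n)%N) : (reg_init (S n) (Q n)).2 =
    - block_mx 0 ((ZA n)^t* *m B n *m ZC n) ((ZC n)^t* *m (B n)^t* *m ZA n) 0.
  by rewrite S_block// Q_block// reg_init_block// ?ZA_inv// ZC_inv.
have delta0_diag n : (1 < n)%N ->
    ulsubmx (reg_init (S n) (Q n)).2 = 0 /\ drsubmx (reg_init (S n) (Q n)).2 = 0.
  move=> n1; rewrite delta0// opp_block_mx !oppr0; split.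
    exact: block_mxKul.
  exact: block_mxKdr.
have delta0_loc n : (1 < n)%N ->
    (loc_init (S n) (Q n)).2 = (reg_init (S n) (Q n)).2.
  by move=> n1; rewrite delta0// S_block// Q_block// loc_init_block.
have [dZreg gDreg] := regular_decays p0 q0 d_pm d_growth m delta0_diag dS dQ l.
have locD := localized_decays p0 q0 d_pm d_growth m delta0_diag delta0_loc dS dQ.
(* The product with [S M] on the right involves the next iterate, so index [l.+1] is required as
   well. *)
have [dZ gD] := locD l; have [dZ' _] := locD l.+1.
have decC := decays_belowC (fun n n1 i j => let: And4 _ h _ _ := d_pm n n1 in h i j).
have gM := decays_to_cut_loc_M p0 q0 d_pm d_growth m dZ gD.
(* The bounds concern runs without stopping test, hence hold in particular for the [n] satisfying
   [P]. *)
have to_decay P X : decays_below d alpha X -> decay P X.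
  by move=> /(_ a aal)[e e0 h]; exists e => // n n1 _; exact: h.
have to_cut P X : decays_to_cut d alpha X -> decay_and_cut P X.
  move=> [dX cX]; split; first exact: to_decay.
  by have [e e0 h] := cX a aal; exists e => // n n1 _; exact: h.
have gSM := decays_to_cutMl p0 q0 d_pm d_growth dS gM.
split; [|move=> k /andP[k0 _]|exact: to_cut|exact: to_cut|]; split.
- exact: to_decay.
- exact: to_decay.
- exact: to_cut (decays_to_cutX p0 q0 d_pm d_growth k0 gDreg).
- exact: to_cut (decays_to_cutX p0 q0 d_pm d_growth k0 gD).
- by apply: to_cut; apply: decays_to_cutMl => //; exact: decC.
- apply: to_cut; apply: decays_to_cutMr => //; apply: decays_to_cutMr => //.
  exact: decays_to_cutC.
Qed.
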